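(* Let $M\in\mathcal{P}_d(\mathbb{Z})$, let $r$ be a non-negative integer, fix a basis of $K^d$ with respect to which $\Lambda(M)$ is formed, and let $B=\mathrm{B}_r(M)$ be the bolytrope with center $Q(\Lambda(M))$ and radius $r$. Then $\Lambda(M)$ is the first term in the radical idealizer chain of the bolytrope order $\mathbb{B}_r(M)=\mathrm{PZ}(B)$ that is a graduated order. Consequently, the central polytrope $Q(\Lambda(M))$ is uniquely determined by the set $B$.
   Context: $K$ is a (commutative) discretely valued field, not necessarily complete, with valuation ring $\mathcal{O}_K$, uniformizer $\pi$ and maximal ideal $\mathfrak{m}_K=\pi\mathcal{O}_K\neq\{0\}$; $d$ is a positive integer. A lattice in $K^d$ is a free $\mathcal{O}_K$-submodule of rank $d$; $[L]=\{\pi^nL\mid n\in\mathbb{Z}\}$ is its homothety class; $\mathcal{B}_d^0(K)$ is the set of all homothety classes. An order in $K^{d\times d}=\mathrm{End}_K(K^d)$ is a free $\mathcal{O}_K$-submodule of rank $d^2$ that is a subring containing the identity. $\mathrm{End}_{\mathcal{O}_K}(L)=\{X\in K^{d\times d}\mid XL\subseteq L\}$. For an order $\Lambda$, $Q(\Lambda)=\{[L]\in\mathcal{B}_d^0(K)\mid\Lambda L=L\}$. An order is graduated if it contains a complete set of orthogonal primitive idempotents $\epsilon_1,\dots,\epsilon_d$ of $K^{d\times d}$. $\mathcal{P}_d(\mathbb{Z})=\{M\in\mathbb{Z}^{d\times d}\mid M_{ii}=0,\ M_{ij}+M_{jk}\ge M_{ik}\text{ for all }i,j,k\}$. For $M\in\mathcal{P}_d(\mathbb{Z})$,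 $\Lambda(M)=\{X\in K^{d\times d}\mid X_{ij}\in\mathfrak{m}_K^{M_{ij}}\text{ for all }i,j\}$, matrices being written with respect to the chosen basis; this is a graduated order. Distance: $\mathrm{dist}([L_1],[L_2])$ is the minimal $s$ such that there are $L_1'\in[L_1]$, $L_2'\in[L_2]$ with $\pi^sL_1'\subseteq L_2'\subseteq L_1'$. $\mathrm{B}_r(M)$ is the set of all $[L]\in\mathcal{B}_d^0(K)$ having distance at most $r$ from some element of $Q(\Lambda(M))$, and $\mathrm{PZ}(\mathcal{L})=\bigcap_{[L]\in\mathcal{L}}\mathrm{End}_{\mathcal{O}_K}(L)$. For an order $\Lambda$, $\mathrm{Jac}(\Lambda)$ is its Jacobson radical; for a full-rank $\mathcal{O}_K$-lattice $N\subset K^{d\times d}$, $\mathrm{Id}(N)=\{X\in K^{d\times d}\mid XN\subseteq N\text{ and }NX\subseteq N\}$. The radical idealizer chain $(\Omega_i)_{i\ge0}$ of $\Lambda$ is defined by $\Omega_0=\Lambda$, $\Omega_{i+1}=\mathrm{Id}(\mathrm{Jac}(\Omega_i))$. ''Uniquely determined by $B$'' means: if $B=\mathrm{B}_r(M)$ and also $B=\mathrm{B}_{r'}(M')$ (with possibly different $r'$, $M'$, and basis of $K^d$), then $Q(\Lambda(M))=Q(\Lambda(M'))$. *)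

(* Defs.v *)
From HB Require Import structures.
From mathcomp Require Import all_boot all_order all_algebra.
From mathcomp Require Import all_classical.

Set Implicit Arguments.
Unset Strict Implicit.
Unset Printing Implicit Defensive.

Import Order.TTheory GRing.Theory Num.Theory.

Local Open Scope classical_set_scope.
Local Open Scope ring_scope.

(* The valuation is normalized (a uniformizer has value 1), and its value at 0,
   which stands for +oo, is left unspecified and does not matter below. *)
Record discrete_valuation (K : fieldType) := DiscreteValuation {
  valuation : K -> int;
  uniformizer : K;
  valuationM : forall x y : K, x != 0 -> y != 0 ->
    valuation (x * y) = valuation x + valuation y;
  valuationD : forall x y : K, x != 0 -> y != 0 -> x + y != 0 ->
    Num.min (valuation x) (valuation y) <= valuation (x + y);
  uniformizer_neq0 : uniformizer != 0;
  valuation_uniformizer : valuation uniformizer = 1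
}.

Definition valuation_ring (K : fieldType) (v : discrete_valuation K) : set K :=
  [set a | a = 0 \/ 0 <= valuation v a].

(* The fractional ideal m_K^n = pi^n O_K, for n of any sign. *)
Definition max_ideal_pow (K : fieldType) (v : discrete_valuation K) (n : int) :
    set K :=
  [set uniformizer v ^ n * a | a in valuation_ring v].

Definition free_submodule (K : fieldType) (v : discrete_valuation K)
    (V : lmodType K) (n : nat) (N : set V) : Prop :=
  exists b : 'I_n -> V,
    (forall a : 'I_n -> K, (forall i, valuation_ring v (a i)) ->
       \sum_i a i *: b i = 0 -> forall i, a i = 0) /\
    N = [set x | exists a : 'I_n -> K,
           (forall i, valuation_ring v (a i)) /\ x = \sum_i a i *: b i].

Definition is_lattice (K : fieldType) (v : discrete_valuation K) (d : nat)
    (L : set 'cV[K]_d) : Prop :=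
  free_submodule v d L.

Definition scale_set (K : fieldType) (d : nat) (c : K) (L : set 'cV[K]_d) :
    set 'cV[K]_d :=
  [set c *: x | x in L].

Definition homothety_class (K : fieldType) (v : discrete_valuation K) (d : nat)
    (L : set 'cV[K]_d) : set (set 'cV[K]_d) :=
  [set scale_set (uniformizer v ^ n) L | n in [set: int]].

Definition building_vertices (K : fieldType) (v : discrete_valuation K)
    (d : nat) : set (set (set 'cV[K]_d)) :=
  [set homothety_class v L | L in [set L | is_lattice v L]].

Definition is_order (K : fieldType) (v : discrete_valuation K) (d : nat)
    (Lam : set 'M[K]_d) : Prop :=
  [/\ free_submodule v (d ^ 2)%N Lam,
      Lam 1%:M &
      forall X Y, Lam X -> Lam Y -> Lam (X *m Y)].

Definition End_lattice (K : fieldType) (d : nat) (L : set 'cV[K]_d) :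
    set 'M[K]_d :=
  [set X | forall x, L x -> L (X *m x)].

(* The product Lam L, consisting of the finite sums of products. *)
Definition order_mul (K : fieldType) (d : nat) (Lam : set 'M[K]_d)
    (L : set 'cV[K]_d) : set 'cV[K]_d :=
  [set y | exists n (X : 'I_n -> 'M[K]_d) (x : 'I_n -> 'cV[K]_d),
     (forall i, Lam (X i) /\ L (x i)) /\ y = \sum_i X i *m x i].

Definition invariant_classes (K : fieldType) (v : discrete_valuation K)
    (d : nat) (Lam : set 'M[K]_d) : set (set (set 'cV[K]_d)) :=
  [set homothety_class v L |
     L in [set L | is_lattice v L /\ order_mul Lam L = L]].

Definition idempotent_mx (K : fieldType) (d : nat) (E : 'M[K]_d) : Prop :=
  E *m E = E.

Definition primitive_idempotent (K : fieldType) (d : nat) (E : 'M[K]_d) :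
    Prop :=
  [/\ idempotent_mx E, E <> 0 &
      forall F G : 'M[K]_d, idempotent_mx F -> idempotent_mx G ->
        F *m G = 0 -> G *m F = 0 -> E = F + G -> F = 0 \/ G = 0].

Definition graduated_order (K : fieldType) (v : discrete_valuation K) (d : nat)
    (Lam : set 'M[K]_d) : Prop :=
  is_order v Lam /\
  exists eps : 'I_d -> 'M[K]_d,
    [/\ forall i, Lam (eps i),
        forall i, primitive_idempotent (eps i),
        forall i j, i != j -> eps i *m eps j = 0 &
        \sum_i eps i = 1%:M].

Definition polytrope_mx (d : nat) (M : 'M[int]_d) : Prop :=
  (forall i, M i i = 0) /\ (forall i j k, M i k <= M i j + M j k).

(* Lambda(M) with respect to the basis e: [coord e i (X *m tnth e j)] is the
   (i, j) entry of the matrix of the endomorphism X in the basis e. *)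
Definition Lambda (K : fieldType) (v : discrete_valuation K) (d : nat)
    (e : d.-tuple 'cV[K]_d) (M : 'M[int]_d) : set 'M[K]_d :=
  [set X | forall i j, max_ideal_pow v (M i j) (coord e i (X *m tnth e j))].

Definition within_dist (K : fieldType) (v : discrete_valuation K) (d : nat)
    (c1 c2 : set (set 'cV[K]_d)) (s : nat) : Prop :=
  exists L1 L2, [/\ c1 L1, c2 L2,
    scale_set (uniformizer v ^+ s) L1 `<=` L2 & L2 `<=` L1].

(* dist c1 c2 = s, as a relation. *)
Definition is_dist (K : fieldType) (v : discrete_valuation K) (d : nat)
    (c1 c2 : set (set 'cV[K]_d)) (s : nat) : Prop :=
  within_dist v c1 c2 s /\ forall t, within_dist v c1 c2 t -> (s <= t)%N.

Definition bolytrope (K : fieldType) (v : discrete_valuation K) (d : nat)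
    (e : d.-tuple 'cV[K]_d) (r : nat) (M : 'M[int]_d) :
    set (set (set 'cV[K]_d)) :=
  [set c | building_vertices v c /\
     exists2 c', invariant_classes v (Lambda v e M) c' &
       exists2 s : nat, is_dist v c c' s & (s <= r)%N].

(* End_{O_K}(L) depends only on the class of L, so all the lattices in the
   classes of C may be taken. *)
Definition PZ (K : fieldType) (v : discrete_valuation K) (d : nat)
    (C : set (set (set 'cV[K]_d))) : set 'M[K]_d :=
  \bigcap_(L in [set L | is_lattice v L /\ C (homothety_class v L)])
    End_lattice L.

Definition left_ideal (K : fieldType) (d : nat) (Lam I : set 'M[K]_d) : Prop :=
  [/\ I `<=` Lam, I 0,
      forall X Y, I X -> I Y -> I (X - Y) &
      forall X Y, Lam X -> I Y -> I (X *m Y)].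

Definition maximal_left_ideal (K : fieldType) (d : nat)
    (Lam I : set 'M[K]_d) : Prop :=
  [/\ left_ideal Lam I, I <> Lam &
      forall J, left_ideal Lam J -> I `<=` J -> J = I \/ J = Lam].

Definition Jac (K : fieldType) (d : nat) (Lam : set 'M[K]_d) : set 'M[K]_d :=
  Lam `&` \bigcap_(I in [set I | maximal_left_ideal Lam I]) I.

Definition idealizer (K : fieldType) (d : nat) (N : set 'M[K]_d) :
    set 'M[K]_d :=
  [set X | forall Y, N Y -> N (X *m Y) /\ N (Y *m X)].

Definition radical_idealizer_chain (K : fieldType) (d : nat)
    (Lam : set 'M[K]_d) (i : nat) : set 'M[K]_d :=
  iter i (fun Om => idealizer (Jac Om)) Lam.

Definition first_graduated_term (K : fieldType) (v : discrete_valuation K)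
    (d : nat) (Lam0 Lam : set 'M[K]_d) : Prop :=
  exists i, [/\ radical_idealizer_chain Lam0 i = Lam,
    graduated_order v Lam &
    forall j, (j < i)%N -> ~ graduated_order v (radical_idealizer_chain Lam0 j)].

(* Main.v *)
Require Import Defs.
From HB Require Import structures.
From mathcomp Require Import all_boot all_order all_algebra.
From mathcomp Require Import all_classical.
From mathcomp Require Import zify ring.

Set Implicit Arguments.
Unset Strict Implicit.
Unset Printing Implicit Defensive.

Import Order.TTheory GRing.Theory Num.Theory.

Local Open Scope classical_set_scope.
Local Open Scope ring_scope.

(** Writing [S_k = O_K + pi^k Lambda(M)], the bolytrope order is [S_r]: a matrix
    preserving all lattices between [pi^r L] and [L] is scalar modulo
    [pi^r End(L)], and it suffices to test this on the lattices [L] generated by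
    the columns of [M].  For [k > 0] the ring [S_k] is local with radical
    [pi S_(k-1)], whose idealizer is [S_(k-1)], so the radical idealizer chain is
    [S_r, S_(r-1), ..., S_0 = Lambda(M)].  A local ring has no idempotents other
    than 0 and 1, so that for [d > 1] no earlier term is graduated; for [d = 1]
    all the [S_k] coincide. *)

(** * Arithmetic of the powers of the maximal ideal *)

Section Valuation.
Variables (K : fieldType) (v : discrete_valuation K).
Local Notation pi := (uniformizer v).
Local Notation mp := (max_ideal_pow v).

Lemma valuation1 : valuation v 1 = 0.
Proof.
have := @valuationM _ v 1 1 (oner_neq0 _) (oner_neq0 _).
by rewrite mulr1; lia.
Qed.

Lemma valuationV (x : K) : x != 0 -> valuation v x^-1 = - valuation v x.
Proof.
move=> x0; have := @valuationM _ v x x^-1 x0; rewrite invr_eq0 => /(_ x0).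
by rewrite mulfV // valuation1; lia.
Qed.

Lemma valuationX (n : nat) : valuation v (pi ^+ n) = n%:Z.
Proof.
elim: n => [|n IHn]; first by rewrite expr0 valuation1.
rewrite exprS valuationM ?expf_neq0 ?uniformizer_neq0 //.
by rewrite valuation_uniformizer IHn; lia.
Qed.

Lemma valuation_expz (n : int) : valuation v (pi ^ n) = n.
Proof.
case: n => n; first exact: valuationX.
by rewrite NegzE -exprnN valuationV ?expf_neq0 ?uniformizer_neq0 // valuationX.
Qed.

Lemma uniformizerX_neq0 (n : nat) : pi ^+ n != 0.
Proof. by rewrite expf_neq0 ?uniformizer_neq0. Qed.

Lemma uniformizer_expz_neq0 (n : int) : pi ^ n != 0.
Proof. by rewrite expfz_neq0 ?uniformizer_neq0. Qed.
Local Hint Resolve uniformizerX_neq0 uniformizer_expz_neq0 : core.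

(** Zero is a case of its own because [valuation v 0] is unspecified. *)
Lemma max_ideal_powE (n : int) (a : K) :
  mp n a <-> a = 0 \/ n <= valuation v a.
Proof.
split=> [[b [-> | vb] <-]|]; first by left; rewrite mulr0.
  have [->|b0] := eqVneq b 0; first by left; rewrite mulr0.
  by right; rewrite valuationM // valuation_expz; lia.
have [->|a0] := eqVneq a 0; first by move=> _; exists 0; [left|rewrite mulr0].
case=> [/eqP|va]; first by rewrite (negPf a0).
exists (pi ^ (- n) * a); last first.
  by rewrite mulrA -expfzDr ?uniformizer_neq0 // subrr expr0z mul1r.
by right; rewrite valuationM // valuation_expz; lia.
Qed.

Lemma valuation_ringE (a : K) : valuation_ring v a <-> mp 0 a.
Proof. by rewrite max_ideal_powE. Qed.

Lemma max_ideal_pow0 (n : int) : mp n 0.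
Proof. by apply/max_ideal_powE; left. Qed.

Lemma max_ideal_powD (n : int) (a b : K) : mp n a -> mp n b -> mp n (a + b).
Proof.
have [->|a0] := eqVneq a 0; first by rewrite add0r.
have [->|b0] := eqVneq b 0; first by rewrite addr0.
have [->|ab0] := eqVneq (a + b) 0; first by move=> *; apply: max_ideal_pow0.
move=> /max_ideal_powE[/eqP|va]; first by rewrite (negPf a0).
move=> /max_ideal_powE[/eqP|vb]; first by rewrite (negPf b0).
apply/max_ideal_powE; right; apply: le_trans (valuationD v a0 b0 ab0).
by rewrite le_min va.
Qed.

Lemma max_ideal_powM (m n : int) (a b : K) :
  mp m a -> mp n b -> mp (m + n) (a * b).
Proof.
have [->|a0] := eqVneq a 0; first by rewrite mul0r => *; apply: max_ideal_pow0.
have [->|b0] := eqVneq b 0; first by rewrite mulr0 => *; apply: max_ideal_pow0.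
move=> /max_ideal_powE[/eqP|va]; first by rewrite (negPf a0).
move=> /max_ideal_powE[/eqP|vb]; first by rewrite (negPf b0).
by apply/max_ideal_powE; right; rewrite valuationM //; lia.
Qed.

Lemma max_ideal_pow_le (m n : int) (a : K) : m <= n -> mp n a -> mp m a.
Proof.
move=> mn /max_ideal_powE[->|va]; first exact: max_ideal_pow0.
by apply/max_ideal_powE; right; apply: le_trans va.
Qed.

Lemma max_ideal_pow_expz (n : int) : mp n (pi ^ n).
Proof. by apply/max_ideal_powE; right; rewrite valuation_expz. Qed.

Lemma max_ideal_pow_expn (n : nat) : mp n%:Z (pi ^+ n).
Proof. exact: max_ideal_pow_expz n%:Z. Qed.

Lemma max_ideal_pow1 : mp 0 1.
Proof. by apply/max_ideal_powE; right; rewrite valuation1. Qed.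
Hint Resolve max_ideal_pow0 max_ideal_pow1 max_ideal_pow_expz : core.

Lemma max_ideal_powMl (n : int) (a b : K) : mp 0 a -> mp n b -> mp n (a * b).
Proof. by move=> ha hb; rewrite -[n]add0r; apply: max_ideal_powM. Qed.

Lemma max_ideal_powN (n : int) (a : K) : mp n a -> mp n (- a).
Proof.
move=> ha; rewrite -mulN1r; apply: max_ideal_powMl => //.
(* The square of -1 is 1, so twice its valuation is 0. *)
apply/max_ideal_powE; right.
have := @valuationM _ v (-1) (-1); rewrite oppr_eq0 oner_eq0 mulrNN mulr1.
by move=> /(_ isT isT); rewrite valuation1; lia.
Qed.

Lemma max_ideal_powB (n : int) (a b : K) : mp n a -> mp n b -> mp n (a - b).
Proof. by move=> ha hb; apply/max_ideal_powD/max_ideal_powN. Qed.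

Lemma max_ideal_pow_sum (I : finType) (P : pred I) (n : int) (F : I -> K) :
  (forall i, P i -> mp n (F i)) -> mp n (\sum_(i | P i) F i).
Proof. by move=> h; apply: big_ind => // a b; apply: max_ideal_powD. Qed.

Lemma max_ideal_pow_nat (n : nat) : mp 0 n%:R.
Proof.
elim: n => [|n IHn] //; rewrite -natr1; exact: max_ideal_powD.
Qed.

Lemma max_ideal_pow_cancel (m n : int) (a : K) :
  mp (m + n) (pi ^ m * a) -> mp n a.
Proof.
move=> h; have -> : a = pi ^ (- m) * (pi ^ m * a).
  by rewrite mulrA -expfzDr ?uniformizer_neq0 // addNr expr0z mul1r.
have -> : n = (- m) + (m + n) by lia.
exact: max_ideal_powM.
Qed.

(** An element of O_K outside the maximal ideal has valuation exactly 0, hence is a unit. *)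
Lemma max_ideal_powV (a : K) : mp 0 a -> ~ mp 1 a -> mp 0 a^-1.
Proof.
move=> /max_ideal_powE[->|va] h; first by case: h.
have [a0|a0] := eqVneq a 0; first by rewrite a0 invr0.
apply/max_ideal_powE; right; rewrite valuationV //.
have : ~ (1 <= valuation v a) by move=> ?; apply: h; apply/max_ideal_powE; right.
by lia.
Qed.

Lemma max_ideal_pow_eq0 (m : int) (a : K) :
  (forall n : nat, mp (m + n%:Z) a) -> a = 0.
Proof.
move=> h; have [//|a0] := eqVneq a 0.
(* This exponent pushes the lower bound above [valuation v a]; taking [absz] can only enlarge it. *)
have /max_ideal_powE[//|] := h (absz (valuation v a - m + 1)).
by lia.
Qed.

Lemma max_ideal_pow_exhaust (m : int) (a : K) :
  exists n0 : nat, forall n : nat, (n0 <= n)%N -> mp m (pi ^+ n * a).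
Proof.
have [->|a0] := eqVneq a 0; first by exists 0%N => n _; rewrite mulr0.
exists (absz (valuation v a - m)) => n hn; apply/max_ideal_powE; right.
by rewrite valuationM // valuationX; lia.
Qed.

End Valuation.

(** * Free modules over the valuation ring *)

Section FreeSubmodules.
Variables (K : fieldType) (v : discrete_valuation K) (V : lmodType K).
Local Notation pi := (uniformizer v).
Local Notation O := (valuation_ring v).
Local Notation mp := (max_ideal_pow v).

(** Any finite index type is allowed, since the basis of Lambda(M) is indexed by pairs. *)
Definition independent_over (I : finType) (b : I -> V) :=
  forall a : I -> K, (forall i, O (a i)) -> \sum_i a i *: b i = 0 ->
    forall i, a i = 0.

Definition span_over (I : finType) (b : I -> V) : set V :=
  [set x | exists a : I -> K, (forall i, O (a i)) /\ x = \sum_i a i *: b i].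

Lemma free_submodule_span (I : finType) (b : I -> V) (n : nat) :
  #|I| = n -> independent_over b -> free_submodule v n (span_over b).
Proof.
move=> <- hb; exists (b \o enum_val); split.
  move=> a ha sum0 t.
  have := hb (a \o enum_rank); rewrite (reindex _ (onW_bij _ (enum_val_bij I))) /=.
  under eq_bigr do rewrite enum_valK.
  by move=> /(_ (fun=> ha _) sum0 (enum_val t)); rewrite /= enum_valK.
apply/seteqP; split=> x [a [ha ->]].
  exists (a \o enum_val); split=> [i|]; first exact: ha.
  by rewrite (reindex _ (onW_bij _ (enum_val_bij I))).
exists (a \o enum_rank); split=> [i|]; first exact: ha.
rewrite [RHS](reindex _ (onW_bij _ (enum_val_bij I))) /=.
by under [RHS]eq_bigr do rewrite enum_valK.
Qed.

Lemma span_overD (I : finType) (b : I -> V) (x y : V) :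
  span_over b x -> span_over b y -> span_over b (x + y).
Proof.
move=> [a [ha ->]] [c [hc ->]]; exists (fun i => a i + c i); split.
  move=> i; apply/valuation_ringE/max_ideal_powD; exact/valuation_ringE.
by rewrite -big_split; apply: eq_bigr => i _; rewrite scalerDl.
Qed.

Lemma span_overZ (I : finType) (b : I -> V) (a : K) (x : V) :
  mp 0 a -> span_over b x -> span_over b (a *: x).
Proof.
move=> ha [c [hc ->]]; exists (fun i => a * c i); split.
  move=> i; apply/valuation_ringE/max_ideal_powMl => //; exact/valuation_ringE.
by rewrite scaler_sumr; apply: eq_bigr => i _; rewrite scalerA.
Qed.

Lemma free_submoduleD (n : nat) (N : set V) (x y : V) :
  free_submodule v n N -> N x -> N y -> N (x + y).
Proof. by move=> [b [_ ->]]; apply: span_overD. Qed.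

Lemma free_submoduleZ (n : nat) (N : set V) (a : K) (x : V) :
  free_submodule v n N -> mp 0 a -> N x -> N (a *: x).
Proof. by move=> [b [_ ->]]; apply: span_overZ. Qed.

(** With [w] the identity matrix this becomes [scalar_plus]; with [w] in a lattice it is a test
    lattice of the bolytrope. *)
Definition adjoin_scaled (k : nat) (w : V) (N : set V) : set V :=
  [set x | exists a y, [/\ O a, N y & x = a *: w + pi ^+ k *: y]].

(* Replacing the basis vector [b i0] by [w] and scaling the others by [pi ^+ k]
   gives a basis of [O w + pi^k N]. *)
Lemma free_submodule_adjoin (I : finType) (b : I -> V) (n k : nat)
    (c : I -> K) (i0 : I) :
  #|I| = n -> independent_over b -> (forall i, mp 0 (c i)) -> c i0 = 1 ->
  free_submodule v n (adjoin_scaled k (\sum_i c i *: b i) (span_over b)).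
Proof.
move=> cI hb hc ci0; set w := \sum_i _.
pose b' i := if i == i0 then w else pi ^+ k *: b i.
have E (a : I -> K) : \sum_i a i *: b' i =
    \sum_i (a i0 * c i + (i != i0)%:R * (a i * pi ^+ k)) *: b i.
  transitivity (a i0 *: w + \sum_(i | i != i0) (a i * pi ^+ k) *: b i).
    rewrite (bigD1 i0) //= {1}/b' eqxx; congr (_ + _).
    by apply: eq_bigr => i /negPf h; rewrite /b' h scalerA.
  rewrite scaler_sumr [X in _ + X]big_mkcond -big_split; apply: eq_bigr => i _ /=.
  rewrite scalerDl scalerA; congr (_ + _).
  by case: eqP => _ /=; rewrite ?mul0r ?scale0r ?mul1r.
suff -> : adjoin_scaled k w (span_over b) = span_over b'.
  apply: free_submodule_span => // a ha; rewrite E => sum0.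
  have ha' i := (valuation_ringE v (a i)).1 (ha i).
  have ab0 := hb _ _ sum0.
  have {}ab0 i : a i0 * c i + (i != i0)%:R * (a i * pi ^+ k) = 0.
    apply: ab0 => j; apply/valuation_ringE/max_ideal_powD.
      exact: max_ideal_powMl.
    apply: max_ideal_powMl; first exact: max_ideal_pow_nat.
    apply: max_ideal_powMl => //.
    by apply: max_ideal_pow_le (max_ideal_pow_expn v k).
  have a0 : a i0 = 0 by have := ab0 i0; rewrite eqxx mul0r addr0 ci0 mulr1.
  move=> i; have [->//|ii0] := eqVneq i i0.
  have /eqP := ab0 i; rewrite a0 ii0 mul0r add0r mul1r mulf_eq0.
  by rewrite (negPf (uniformizerX_neq0 v k)) orbF => /eqP.
have hpi : mp 0 (pi ^+ k) by apply: max_ideal_pow_le (max_ideal_pow_expn v k).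
apply/seteqP; split=> x.
  move=> [a [y [/valuation_ringE ha [f [hf ->]] ->]]].
  have hf' i := (valuation_ringE v (f i)).1 (hf i).
  (* These are the coordinates in [b']: as c_i0 = 1, the vector pi^k b_i0 equals pi^k w minus the
     sum of the c_i pi^k b_i over the other i. *)
  exists (fun i => if i == i0 then a + pi ^+ k * f i0 else f i - c i * f i0).
  split=> [i|].
    apply/valuation_ringE; case: eqP => _.
      by apply: max_ideal_powD => //; apply: max_ideal_powMl.
    by apply: max_ideal_powB => //; apply: max_ideal_powMl.
  rewrite E !scaler_sumr -big_split; apply: eq_bigr => i _ /=.
  rewrite !scalerA -scalerDl; congr (_ *: _).
  rewrite eqxx; case: eqVneq => [->|_] /=; first by rewrite ci0 mul0r addr0 !mulr1.
  ring.
move=> [a [ha ->]]; exists (a i0); exists (\sum_i ((i != i0)%:R * a i) *: b i).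
split=> //.
  exists (fun i => (i != i0)%:R * a i); split=> // i; apply/valuation_ringE.
  apply: max_ideal_powMl; first exact: max_ideal_pow_nat.
  exact/valuation_ringE.
rewrite E /w !scaler_sumr -big_split; apply: eq_bigr => i _ /=.
by rewrite !scalerA -scalerDl [pi ^+ k * _]mulrC mulrA.
Qed.

End FreeSubmodules.

(** * Units, radical and idempotents of the rings O_K + pi^k Lambda *)

Section FullOrders.
Variables (K : fieldType) (v : discrete_valuation K) (d : nat).
Local Notation pi := (uniformizer v).
Local Notation O := (valuation_ring v).
Local Notation mp := (max_ideal_pow v).

(* The last two fields hold for every order in [K^(d x d)], since it is free of
   full rank. *)
Record full_order (Lam : set 'M[K]_d) : Prop := FullOrder {
  full_order1 : Lam 1%:M;
  full_orderD : forall X Y, Lam X -> Lam Y -> Lam (X + Y);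
  full_orderZ : forall a X, mp 0 a -> Lam X -> Lam (a *: X);
  full_orderM : forall X Y, Lam X -> Lam Y -> Lam (X *m Y);
  full_order_exhaust : forall X, exists n : nat, Lam (pi ^+ n *: X);
  full_order_separated : forall X,
    (forall n : nat, exists2 Y, Lam Y & X = pi ^+ n *: Y) -> X = 0
}.

Definition scalar_plus (Lam : set 'M[K]_d) (k : nat) : set 'M[K]_d :=
  [set X | exists a Y, [/\ mp 0 a, Lam Y & X = a%:M + pi ^+ k *: Y]].

Variable Lam : set 'M[K]_d.
Hypothesis LamP : full_order Lam.
Local Notation S := (scalar_plus Lam).

Let pi_int (k : nat) : mp 0 (pi ^+ k).
Proof. exact: max_ideal_pow_le (max_ideal_pow_expn v k). Qed.

Lemma full_order_scalar (a : K) : mp 0 a -> Lam a%:M.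
Proof.
by move=> ha; rewrite -scalemx1; apply: (full_orderZ LamP) => //; apply: full_order1.
Qed.

Lemma full_order0 : Lam 0.
Proof.
rewrite -(scale0r (1%:M : 'M[K]_d)).
apply: (full_orderZ LamP); [exact: max_ideal_pow0|exact: full_order1].
Qed.

Lemma full_orderN X : Lam X -> Lam (- X).
Proof.
move=> hX; rewrite -scaleN1r; apply: (full_orderZ LamP) => //.
exact/max_ideal_powN/max_ideal_pow1.
Qed.

Lemma full_orderB X Y : Lam X -> Lam Y -> Lam (X - Y).
Proof. by move=> hX hY; apply: (full_orderD LamP) => //; apply: full_orderN. Qed.

(** K need not be complete, so the geometric series is truncated: iterating W = x W - pi Z W leaves
    a remainder pi^n P W with P in Lambda. Separatedness then makes the kernel of x trivial, and
    exhaustion makes the remainder for W = x^-1 integral. *)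
Lemma full_order_one_plus_unit Z : Lam Z ->
  1%:M + pi *: Z \in unitmx /\ Lam (invmx (1%:M + pi *: Z)).
Proof.
move=> hZ; set x := _ + _.
have xW (W : 'M[K]_d) : W = x *m W - pi *: (Z *m W) by rewrite mulmxDl mul1mx -scalemxAl addrK.
clearbody x; have iter_eq (W : 'M[K]_d) (n : nat) :
    exists G P, [/\ Lam G, Lam P & W = G *m (x *m W) + pi ^+ n *: (P *m W)].
  elim: n => [|n [G [P [hG hP eW]]]].
    exists 0, 1%:M; split; [exact: full_order0|exact: full_order1|].
    by rewrite mul0mx add0r expr0 scale1r mul1mx.
  exists (G + pi ^+ n *: P), (- (P *m Z)); split.
  - by apply: (full_orderD LamP) => //; apply: (full_orderZ LamP).
  - exact/full_orderN/(full_orderM LamP).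
  rewrite {1}eW mulmxDl -addrA; congr (_ + _).
  rewrite {1}(xW W).
  rewrite mulmxBr scalerBr -[in RHS]scalemxAl; congr (_ + _).
  by rewrite mulNmx scalerN -scalemxAr scalerA exprSr mulmxA.
have ux : x \in unitmx.
  (* [kermx] is a left kernel, hence the transposes. *)
  rewrite -unitmx_tr -row_free_unit -kermx_eq0; apply/eqP.
  rewrite -[LHS]trmxK -[RHS]trmxK; congr (_^T); rewrite trmx0.
  set W := (kermx x^T)^T.
  have xW0 : x *m W = 0.
    by apply: trmx_inj; rewrite trmx_mul trmxK mulmx_ker trmx0.
  (* The factor pi^m clears the denominators of [W]; running n + m rounds leaves n further factors
     pi. *)
  have [m hm] := full_order_exhaust LamP W.
  apply: (full_order_separated LamP) => n.
  have [G [P [_ hP eW]]] := iter_eq W (n + m)%N.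
  exists (P *m (pi ^+ m *: W)); first exact: (full_orderM LamP).
  by rewrite {1}eW xW0 mulmx0 add0r -scalemxAr scalerA -exprD.
split=> //.
have [m hm] := full_order_exhaust LamP (invmx x).
have [G [P [hG hP ->]]] := iter_eq (invmx x) m.
rewrite mulmxV // mulmx1; apply: (full_orderD LamP) => //.
by rewrite scalemxAr; apply: (full_orderM LamP).
Qed.

Lemma scalar_plus_incl k X : S k X -> Lam X.
Proof.
move=> [a [Y [ha hY ->]]]; apply: (full_orderD LamP).
  exact: full_order_scalar.
exact: (full_orderZ LamP).
Qed.

Lemma scalar_plus0 : S 0 = Lam.
Proof.
apply/seteqP; split=> X; first exact: scalar_plus_incl.
move=> hX; exists 0, X; split=> //; first exact: max_ideal_pow0.
by rewrite raddf0 add0r expr0 scale1r.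
Qed.

Lemma scalar_plus_scalar k a : mp 0 a -> S k a%:M.
Proof.
by move=> ha; exists a, 0; split=> //; [exact: full_order0|rewrite scaler0 addr0].
Qed.

Lemma scalar_plus1 k : S k 1%:M.
Proof. exact/scalar_plus_scalar/max_ideal_pow1. Qed.

Lemma scalar_plus_0 k : S k 0.
Proof.
rewrite -(raddf0 (@scalar_mx K d)); exact/scalar_plus_scalar/max_ideal_pow0.
Qed.

Lemma scalar_plusB k X Y : S k X -> S k Y -> S k (X - Y).
Proof.
move=> [a [X' [ha hX ->]]] [b [Y' [hb hY ->]]]; exists (a - b), (X' - Y').
split; [exact: max_ideal_powB|exact: full_orderB|].
by rewrite raddfB /= scalerBr opprD addrACA.
Qed.

Lemma scalar_plusM k X Y : S k X -> S k Y -> S k (X *m Y).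
Proof.
move=> [a [X' [ha hX ->]]] [b [Y' [hb hY ->]]].
exists (a * b), (a *: Y' + X' *m (b%:M + pi ^+ k *: Y')); split.
- exact: max_ideal_powMl.
- apply: (full_orderD LamP); first exact: (full_orderZ LamP).
  apply: (full_orderM LamP) => //; apply: (@scalar_plus_incl k).
  by exists b, Y'.
rewrite mulmxDl mulmxDr scalerDr -addrA; congr (_ + _).
  by rewrite mul_scalar_mx scale_scalar_mx.
congr (_ + _); last by rewrite scalemxAl.
by rewrite mul_scalar_mx !scalerA mulrC.
Qed.

(** Write X = a + pi^(k+1) Y. If pi divides a, then it divides X, at the price of lowering the
    index; otherwise X = a (1 + pi Z) with Z = pi^k a^-1 Y. *)
Lemma scalar_plus_unit k X : S k.+1 X ->
  (exists2 Y, S k Y & X = pi *: Y) \/ (X \in unitmx /\ S k.+1 (invmx X)).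
Proof.
move=> [a [Y [ha hY eX]]]; have [ha1|ha1] := pselect (mp 1 a).
  left; exists ((pi^-1 * a)%:M + pi ^+ k *: Y).
    exists (pi^-1 * a), Y; split=> //.
    apply: (@max_ideal_pow_cancel _ v 1).
    by rewrite expr1z mulVKf ?uniformizer_neq0 ?addr0.
  rewrite eX scalerDr scale_scalar_mx mulVKf ?uniformizer_neq0 //.
  by rewrite scalerA exprS.
right; have a0 : a != 0.
  by apply/eqP => a0; apply: ha1; rewrite a0; apply: max_ideal_pow0.
have hV := max_ideal_powV ha ha1.
pose Z := pi ^+ k *: (a^-1 *: Y); have hZ : Lam Z by do 2!apply: (full_orderZ LamP) => //.
have [ux hx] := full_order_one_plus_unit hZ; set x := _ + _ in ux hx.
have {}eX : X = a *: x.
  rewrite eX /x /Z scalerDr scalemx1 !scalerA exprS; congr (_ + _ *: _).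
  by field.
have uX : X \in unitmx by rewrite eX unitmxZ ?unitfE.
split=> //.
(* Membership of the inverse in [Lam] is too weak; x^-1 = 1 - pi Z x^-1 shows that it is scalar
   modulo pi^(k+1). *)
have xV : invmx x = 1%:M - pi ^+ k.+1 *: (a^-1 *: (Y *m invmx x)).
  rewrite -[LHS](addrK (pi *: (Z *m invmx x))) scalemxAl -{1}[invmx x]mul1mx.
  rewrite -mulmxDl mulmxV //; congr (_ - _).
  by rewrite /Z -!scalemxAl !scalerA exprS.
have -> : invmx X = a^-1 *: invmx x by rewrite eX invmxZ ?unitmxZ ?unitfE // -eX.
exists a^-1, (- (a^-1 *: (a^-1 *: (Y *m invmx x)))); split=> //.
  by apply: full_orderN; do 2!apply: (full_orderZ LamP) => //; apply: (full_orderM LamP).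
rewrite {1}xV scalerBr scalemx1 scalerN; congr (_ - _).
by rewrite !scalerA; congr (_ *: _); ring.
Qed.

(** If pi were invertible in Lambda, then 1 = pi^n pi^-n would be divisible by every power of pi.
    This makes pi S_k a proper left ideal. *)
Lemma scalar_plus_pi_neq1 k Y : (0 < d)%N -> S k Y -> pi *: Y <> 1%:M.
Proof.
move=> d0 /scalar_plus_incl hY E.
have piV : Lam (pi^-1)%:M.
  suff -> : (pi^-1)%:M = Y by [].
  by rewrite -scalemx1 -E scalerA mulVf ?uniformizer_neq0 ?scale1r.
have : (1%:M : 'M[K]_d) = 0.
  apply: (full_order_separated LamP) => n; exists ((pi^-1) ^+ n)%:M.
    elim: n => [|n IHn]; first by rewrite expr0; apply: full_order1.
    rewrite exprS scalar_mxM.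
    exact: (full_orderM LamP).
  by rewrite scale_scalar_mx -exprMn mulfV ?uniformizer_neq0 ?expr1n.
by move=> /matrixP/(_ (Ordinal d0) (Ordinal d0))/eqP; rewrite !mxE eqxx oner_eq0.
Qed.

Lemma scalar_plus_pi_left_ideal k : left_ideal (S k.+1) [set pi *: Y | Y in S k].
Proof.
have sub : S k.+1 `<=` S k.
  move=> X [a [Y [ha hY ->]]]; exists a, (pi *: Y); split=> //.
    by apply: (full_orderZ LamP) => //; apply: (pi_int 1).
  by rewrite scalerA exprSr.
split.
- move=> _ [X [a [Y [ha hY ->]]] <-]; exists (pi * a), Y; split=> //.
    by apply: max_ideal_powMl => //; apply: (pi_int 1).
  by rewrite scalerDr scale_scalar_mx scalerA exprS.
- by exists 0; [exact: scalar_plus_0|rewrite scaler0].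
- move=> _ _ [X hX <-] [Y hY <-]; exists (X - Y); last by rewrite scalerBr.
  exact: scalar_plusB.
- move=> X _ hX [Y hY <-]; exists (X *m Y); last by rewrite scalemxAr.
  by apply: scalar_plusM => //; apply: sub.
Qed.

Lemma left_ideal_unit k I X : left_ideal (S k) I -> I X -> X \in unitmx ->
  S k (invmx X) -> I = S k.
Proof.
move=> [sub _ _ mulI] hX uX hV; apply/seteqP; split=> // Y hY.
by rewrite -[Y]mulmx1 -(mulVmx uX) mulmxA; apply: mulI => //; apply: scalar_plusM.
Qed.

(** A proper left ideal contains no unit of the ring, so [scalar_plus_unit] leaves only multiples of
    pi. *)
Lemma left_ideal_sub_pi k I : left_ideal (S k.+1) I ->
  I <> S k.+1 -> I `<=` [set pi *: Y | Y in S k].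
Proof.
move=> hI neq X hX; have [sub _ _ _] := hI.
case: (scalar_plus_unit (sub _ hX)) => [[Y hY ->]|[uX hV]]; first by exists Y.
by case: neq; apply: left_ideal_unit hI hX uX hV.
Qed.

(** The left ideal pi S_k is proper and contains every proper left ideal, so it is the unique
    maximal one. *)
Lemma Jac_scalar_plus k : (0 < d)%N ->
  Jac (S k.+1) = [set pi *: Y | Y in S k].
Proof.
move=> d0; have hJ := scalar_plus_pi_left_ideal k.
have neq : [set pi *: Y | Y in S k] <> S k.+1.
  move=> E; have : S k.+1 1%:M by exact: scalar_plus1.
  by rewrite -E => -[Y hY]; apply: scalar_plus_pi_neq1 d0 hY.
have [sub _ _ _] := hJ.
apply/seteqP; split=> X.
  move=> [_ hX]; apply: hX; split=> // J hL JJ.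
  have [->|neqJ] := pselect (J = S k.+1); first by right.
  by left; apply/seteqP; split=> //; apply: left_ideal_sub_pi.
move=> hX; split; first exact: sub.
move=> I [hI neqI maxI].
have IJ := left_ideal_sub_pi hI neqI.
case: (maxI _ hJ IJ) => E; last by case: neq.
by rewrite -E.
Qed.

(** For the inclusion into S_k, test X on pi times the identity and cancel pi. *)
Lemma idealizer_pi_scalar_plus k : idealizer [set pi *: Y | Y in S k] = S k.
Proof.
have pi0 := uniformizer_neq0 v.
apply/seteqP; split=> X.
  move=> /(_ (pi *: 1%:M)) [|[Y hY]]; first by exists 1%:M => //; apply: scalar_plus1.
  by rewrite -scalemxAr mulmx1 => /(scalerI pi0) <-.
move=> hX _ [Y hY <-]; split.
  by exists (X *m Y); [exact: scalar_plusM|rewrite scalemxAr].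
by exists (Y *m X); [exact: scalar_plusM|rewrite scalemxAl].
Qed.

(** Each step lowers the index by one; the form [k + i] lets the induction hypothesis be used at
    [k.+1]. *)
Lemma radical_idealizer_chain_scalar_plus i k : (0 < d)%N ->
  radical_idealizer_chain (S (k + i)) i = S k.
Proof.
move=> d0; elim: i k => [|i IHi] k; first by rewrite addn0.
by rewrite /radical_idealizer_chain iterS -/(radical_idealizer_chain _ _)
  -addSnnS IHi Jac_scalar_plus // idealizer_pi_scalar_plus.
Qed.

(** An idempotent divisible by pi equals all its powers, hence is divisible by every power of pi. *)
Lemma pi_idempotent Y : Lam Y -> idempotent_mx (pi *: Y) -> pi *: Y = 0.
Proof.
move=> hY idem; apply: (full_order_separated LamP) => n.
suff [Z hZ ->] : exists2 Z, Lam Z & pi *: Y = pi ^+ n.+1 *: Z.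
  by exists (pi *: Z); [apply: (full_orderZ LamP _ hZ); exact: (pi_int 1)|rewrite scalerA exprSr].
elim: n => [|n [Z hZ E]]; first by exists Y; rewrite ?expr1.
exists (Y *m Z); first exact: (full_orderM LamP).
by rewrite -{1}idem {2}E -scalemxAr -scalemxAl scalerA [in RHS]exprSr.
Qed.

(** By [scalar_plus_unit] an idempotent is divisible by pi or invertible, and an invertible
    idempotent is 1. *)
Lemma scalar_plus_idempotent k E : S k.+1 E -> idempotent_mx E ->
  E = 0 \/ E = 1%:M.
Proof.
move=> hE idem; case: (scalar_plus_unit hE) => [[Y hY eE]|[uE _]].
  by left; move: idem; rewrite eE; apply: pi_idempotent; apply: scalar_plus_incl hY.
by right; rewrite -[LHS]mul1mx -(mulVmx uE) -mulmxA idem.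
Qed.

(** All the primitive idempotents would be 1, but for d > 1 there are two of them with product 0. *)
Lemma scalar_plus_not_graduated k : (1 < d)%N -> ~ graduated_order v (S k.+1).
Proof.
move=> d1 [_ [eps [hS prim orth _]]].
have eps1 i : eps i = 1%:M.
  have [idem n0 _] := prim i.
  by case: (scalar_plus_idempotent (hS i) idem).
have := orth (Ordinal (ltnW d1)) (Ordinal d1) isT.
rewrite !eps1 mulmx1 => one0.
by have [_] := prim (Ordinal d1); rewrite eps1 one0.
Qed.

End FullOrders.

(** * Modules given by bounds on the valuations of coordinates *)

Section Boxes.
Variables (K : fieldType) (v : discrete_valuation K) (V : lmodType K).
Variables (I : finType) (u : I -> V) (phi : I -> V -> K).
Hypothesis phi_expand : forall x, x = \sum_i phi i x *: u i.
Hypothesis phi_sum : forall a i, phi i (\sum_j a j *: u j) = a i.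
Local Notation pi := (uniformizer v).
Local Notation mp := (max_ideal_pow v).
Variable m : I -> int.

Lemma box_independent : independent_over v (fun i => pi ^ m i *: u i).
Proof.
move=> a _ sum0 i; have := phi_sum (fun i => a i * pi ^ m i) i.
under eq_bigr do rewrite -scalerA; rewrite sum0.
(* The values of [phi] are known on combinations of the [u j], so 0 is written as one. *)
have -> : 0 = \sum_(j : I) 0 *: u j by rewrite big1 // => j _; rewrite scale0r.
rewrite (phi_sum (fun=> 0)) => /esym/eqP; rewrite mulf_eq0.
by rewrite (negPf (uniformizer_expz_neq0 v _)) orbF => /eqP.
Qed.

(** Serves both for the basis [e] of K^d and for the matrix units. *)
Lemma box_span : span_over v (fun i => pi ^ m i *: u i) =
  [set x | forall i, mp (m i) (phi i x)].
Proof.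
apply/seteqP; split=> x.
  move=> [a [ha ->]] i; under eq_bigr do rewrite scalerA.
  rewrite phi_sum; apply: max_ideal_powMl; first exact/valuation_ringE.
  exact: max_ideal_pow_expz.
move=> hx; have hx' i : exists y, valuation_ring v y /\ pi ^ m i * y = phi i x.
  by have [y] := hx i; exists y.
have [a ha] := choice hx'.
exists a; split=> [i|]; first by have [] := ha i.
rewrite [LHS]phi_expand; apply: eq_bigr => i _; rewrite scalerA mulrC.
by have [_ ->] := ha i.
Qed.

End Boxes.

(** * Matrix entries in the basis [e] and the order Lambda(M) *)

Section Coordinates.
Variables (K : fieldType) (v : discrete_valuation K) (d : nat).
Variables (e : d.-tuple 'cV[K]_d) (he : basis_of {:'cV[K]_d} e).
Local Notation pi := (uniformizer v).
Local Notation mp := (max_ideal_pow v).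

Lemma coord_expand (x : 'cV[K]_d) : x = \sum_i coord e i x *: tnth e i.
Proof.
rewrite {1}(coord_basis he (memvf x)); apply: eq_bigr => i _.
by rewrite (tnth_nth 0).
Qed.

Lemma coord_sum (a : 'I_d -> K) (i : 'I_d) :
  coord e i (\sum_j a j *: tnth e j) = a i.
Proof.
rewrite -(coord_sum_free a i (basis_free he)); congr (coord _ _ _).
by apply: eq_bigr => j _; rewrite (tnth_nth 0).
Qed.

Lemma coord_tnth (i j : 'I_d) : coord e i (tnth e j) = (i == j)%:R.
Proof. by rewrite (tnth_nth 0) coord_free ?(basis_free he) // eq_sym. Qed.

Definition entry (X : 'M[K]_d) (i j : 'I_d) : K := coord e i (X *m tnth e j).

Lemma entryD X Y i j : entry (X + Y) i j = entry X i j + entry Y i j.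
Proof. by rewrite /entry mulmxDl linearD. Qed.

Lemma entryZ a X i j : entry (a *: X) i j = a * entry X i j.
Proof. by rewrite /entry -scalemxAl linearZ. Qed.

Lemma entry0 i j : entry 0 i j = 0.
Proof. by rewrite /entry mul0mx linear0. Qed.

Lemma coord_mulmx X x i : coord e i (X *m x) = \sum_k entry X i k * coord e k x.
Proof.
rewrite {1}(coord_expand x) mulmx_sumr linear_sum; apply: eq_bigr => k _.
by rewrite -scalemxAr linearZ /= mulrC.
Qed.

Lemma entryM X Y i j : entry (X *m Y) i j = \sum_k entry X i k * entry Y k j.
Proof. by rewrite /entry -mulmxA coord_mulmx. Qed.

Lemma entry_scalar a i j : entry a%:M i j = a * (i == j)%:R.
Proof. by rewrite /entry mul_scalar_mx linearZ /= coord_tnth. Qed.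

Lemma mulmx_ext (X Y : 'M[K]_d) : (forall x : 'cV_d, X *m x = Y *m x) -> X = Y.
Proof.
by move=> h; apply/matrixP => i j; have /colP/(_ i) := h (delta_mx j 0);
  rewrite -!colE !mxE.
Qed.

Lemma entry_inj X Y : (forall i j, entry X i j = entry Y i j) -> X = Y.
Proof.
move=> h; apply: mulmx_ext => x.
rewrite [LHS]coord_expand [RHS]coord_expand; apply: eq_bigr => i _.
by congr (_ *: _); rewrite !coord_mulmx; apply: eq_bigr => k _; rewrite h.
Qed.

(** The endomorphism that sends e_j to e_i and kills the other basis vectors; the row lists the
    values of the j-th coordinate form on the standard basis. *)
Definition matrix_unit (i j : 'I_d) : 'M[K]_d :=
  tnth e i *m \row_l coord e j (delta_mx l 0).

Lemma mul_matrix_unit i j x : matrix_unit i j *m x = coord e j x *: tnth e i.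
Proof.
rewrite -mulmxA; set y := _ *m x.
suff -> : y = (coord e j x)%:M by rewrite mul_mx_scalar.
apply/matrixP => a b; rewrite !ord1 !mxE eqxx mulr1n.
have {2}-> : x = \sum_l x l 0 *: delta_mx l 0.
  apply/colP => l; rewrite summxE (bigD1 l) //= !mxE !eqxx mulr1 big1 ?addr0 //.
  by move=> k /negPf kl; rewrite !mxE eq_sym kl mulr0.
by rewrite linear_sum; apply: eq_bigr => l _; rewrite linearZ !mxE mulrC.
Qed.

Lemma entry_matrix_unit i j k l :
  entry (matrix_unit i j) k l = ((k, l) == (i, j))%:R.
Proof.
rewrite /entry mul_matrix_unit linearZ /= !coord_tnth -natrM mulnb xpair_eqE.
by rewrite andbC [j == l]eq_sym.
Qed.

Lemma entry_sum_units (a : 'I_d * 'I_d -> K) (p : 'I_d * 'I_d) :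
  entry (\sum_q a q *: matrix_unit q.1 q.2) p.1 p.2 = a p.
Proof.
rewrite /entry mulmx_suml linear_sum (bigD1 p) //= -/(entry _ _ _) entryZ.
rewrite entry_matrix_unit eqxx mulr1 big1 ?addr0 // => q /negPf qp.
rewrite -/(entry _ _ _) entryZ entry_matrix_unit -!surjective_pairing eq_sym qp.
by rewrite mulr0.
Qed.

Lemma entry_expand X : X = \sum_p entry X p.1 p.2 *: matrix_unit p.1 p.2.
Proof.
by apply: entry_inj => i j; rewrite (entry_sum_units _ (i, j)).
Qed.

Variables (M : 'M[int]_d) (hM : polytrope_mx M).
Local Notation Lam := (Lambda v e M).

(** The zero diagonal of M gives the identity, the triangle inequality gives products. *)
Lemma Lambda_full_order : full_order v Lam.
Proof.
have [M0 Mtri] := hM; split.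
- move=> i j; rewrite -/(entry _ _ _) entry_scalar mul1r.
  case: eqVneq => [->|_]; last exact: max_ideal_pow0.
  by rewrite M0; apply: max_ideal_pow1.
- by move=> X Y hX hY i j; rewrite -/(entry _ _ _) entryD; apply: max_ideal_powD.
- by move=> a X ha hX i j; rewrite -/(entry _ _ _) entryZ; apply: max_ideal_powMl.
- move=> X Y hX hY i j; rewrite -/(entry _ _ _) entryM.
  apply: max_ideal_pow_sum => k _.
  by apply: max_ideal_pow_le (Mtri i k j) _; apply: max_ideal_powM.
- move=> X.
  have [n hn] := choice (fun p : 'I_d * 'I_d =>
    max_ideal_pow_exhaust v (M p.1 p.2) (entry X p.1 p.2)).
  (* The maximum is one exponent that serves all entries. *)
  exists (\max_p n p)%N => i j; rewrite -/(entry _ _ _) entryZ.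
  exact: (hn (i, j)) (leq_bigmax (i, j)).
- move=> X hX; apply: entry_inj => i j.
  rewrite entry0.
  apply: (@max_ideal_pow_eq0 _ v (M i j)) => n; have [Y hY ->] := hX n.
  rewrite entryZ addrC; apply: max_ideal_powM; last exact: hY.
  exact: max_ideal_pow_expn.
Qed.

Let Lam_basis (p : 'I_d * 'I_d) := pi ^ M p.1 p.2 *: matrix_unit p.1 p.2.

Lemma Lambda_span : Lam = span_over v Lam_basis.
Proof.
rewrite (box_span v entry_expand entry_sum_units (fun p => M p.1 p.2)).
apply/seteqP; split=> X hX; first by move=> p; apply: hX.
by move=> i j; apply: (hX (i, j)).
Qed.

(** Since M_ii = 0, the identity is a combination of the basis of Lambda(M) with coefficient 1 at
    each diagonal place, so [free_submodule_adjoin] applies. *)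
Lemma free_scalar_plus_Lambda k : (0 < d)%N ->
  free_submodule v (d ^ 2) (scalar_plus v Lam k).
Proof.
move=> d0.
have -> : scalar_plus v Lam k = adjoin_scaled v k 1%:M Lam.
  by apply/seteqP; split=> _ [a [Y [/valuation_ringE ha hY ->]]];
    exists a, Y; split=> //; rewrite scalemx1.
have -> : 1%:M = \sum_p (p.1 == p.2)%:R *: Lam_basis p.
  rewrite [LHS]entry_expand; apply: eq_bigr => -[i j] _ /=.
  rewrite entry_scalar mul1r /Lam_basis /=; case: eqVneq => [->|]; last by rewrite !scale0r.
  by rewrite (proj1 hM) expr0z !scale1r.
rewrite Lambda_span.
apply: (@free_submodule_adjoin _ _ _ _ _ _ _ _ (Ordinal d0, Ordinal d0)).
- by rewrite card_prod card_ord mulnn.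
- exact: (box_independent (phi := fun p X => entry X p.1 p.2) entry_sum_units).
- by move=> p; apply: max_ideal_pow_nat.
- by rewrite eqxx.
Qed.

Lemma scalar_plus_Lambda_is_order k : (0 < d)%N -> is_order v (scalar_plus v Lam k).
Proof.
move=> d0; split; first exact: free_scalar_plus_Lambda.
  exact: scalar_plus1 Lambda_full_order _.
by move=> X Y; apply: scalar_plusM Lambda_full_order _ _ _.
Qed.

(** With [X] the identity this is the multiplication table of the matrix units; with equal indices
    it compresses [X] to a corner of rank one. *)
Lemma matrix_unit_mul i j X k l :
  matrix_unit i j *m X *m matrix_unit k l = entry X j k *: matrix_unit i l.
Proof.
apply: mulmx_ext => x; rewrite -scalemxAl -(mulmxA _ _ x) -(mulmxA _ X) !mul_matrix_unit.
by rewrite -scalemxAr linearZ /= scalerA mulrC.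
Qed.

(** In an orthogonal decomposition E = F + G one has F = E F E, a scalar multiple of E, and likewise
    for G; then F G = 0 makes one of the two scalars vanish. *)
Lemma primitive_matrix_unit i : primitive_idempotent (matrix_unit i i).
Proof.
have idem : idempotent_mx (matrix_unit i i).
  have := matrix_unit_mul i i 1%:M i i.
  by rewrite mulmx1 entry_scalar eqxx mulr1 scale1r.
have n0 : matrix_unit i i <> 0.
  move=> E; have := entry_matrix_unit i i i i; rewrite E eqxx entry0.
  by move/eqP; rewrite eq_sym oner_eq0.
split=> // F G hF hG FG GF E.
have corner H H' : idempotent_mx H -> H *m H' = 0 -> H' *m H = 0 ->
    matrix_unit i i = H + H' -> H = entry H i i *: matrix_unit i i.
  move=> hH HH' H'H eH; rewrite -matrix_unit_mul eH mulmxDl H'H addr0 hH.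
  by rewrite mulmxDr HH' addr0 hH.
have eF := corner F G hF FG GF E.
have eG : G = entry G i i *: matrix_unit i i by apply: (corner G F); rewrite // addrC.
move: FG; rewrite eF eG -scalemxAr -scalemxAl idem scalerA => /eqP.
rewrite scaler_eq0 (introF eqP n0) orbF mulf_eq0 => /orP[] /eqP ->.
  by right; rewrite scale0r.
by left; rewrite scale0r.
Qed.

Lemma Lambda_graduated : (0 < d)%N -> graduated_order v Lam.
Proof.
move=> d0; split.
  by rewrite -(scalar_plus0 Lambda_full_order); apply: scalar_plus_Lambda_is_order.
exists (fun i => matrix_unit i i); split.
- move=> i k l; rewrite -/(entry _ _ _) entry_matrix_unit.
  case: eqVneq => [[-> ->]|_]; last exact: max_ideal_pow0.
  by rewrite (proj1 hM); apply: max_ideal_pow1.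
- exact: primitive_matrix_unit.
- move=> i j ij; have := matrix_unit_mul i i 1%:M j j.
  by rewrite mulmx1 entry_scalar (negPf ij) mulr0 scale0r.
- apply: mulmx_ext => x; rewrite mulmx_suml mul1mx [RHS]coord_expand.
  by apply: eq_bigr => i _; rewrite mul_matrix_unit.
Qed.

End Coordinates.

(** * Identification of the bolytrope order with S_r *)

Section Bolytrope.
Variables (K : fieldType) (v : discrete_valuation K) (d : nat).
Local Notation pi := (uniformizer v).
Local Notation mp := (max_ideal_pow v).

Lemma homothety_class_refl (L : set 'cV[K]_d) : homothety_class v L L.
Proof.
exists 0 => //; apply/seteqP; split=> x.
  by move=> [y hy <-]; rewrite expr0z scale1r.
by move=> hx; exists x; rewrite ?expr0z ?scale1r.
Qed.

(** [bolytrope] asks for the exact distance, so a bound has to be turned into a minimum. *)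
Lemma is_dist_le (c c' : set (set 'cV[K]_d)) (r : nat) :
  within_dist v c c' r -> exists2 s, is_dist v c c' s & (s <= r)%N.
Proof.
move=> hr; have ex : exists s, `[< within_dist v c c' s >] by exists r; apply/asboolP.
case: (ex_minnP ex) => s /asboolP hs mins; exists s; last by apply/mins/asboolP.
by split=> // t ht; apply/mins/asboolP.
Qed.

(** The second representative must lie inside the first, so the classes are compared through L and
    pi^r L'. *)
Lemma within_dist_homothety (L L' : set 'cV[K]_d) (r : nat) :
  scale_set (pi ^+ r) L' `<=` L -> L `<=` L' ->
  within_dist v (homothety_class v L) (homothety_class v L') r.
Proof.
move=> sub1 sub2; exists L, (scale_set (pi ^+ r) L'); split=> //.
- exact: homothety_class_refl.
- by exists r%:Z.
- by move=> _ [x hx <-]; exists x => //; apply: sub2.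
Qed.

Variables (e : d.-tuple 'cV[K]_d) (he : basis_of {:'cV[K]_d} e).
Variables (M : 'M[int]_d) (hM : polytrope_mx M).
Local Notation Lam := (Lambda v e M).

(** Up to homothety, pi^s moves x from L into the invariant lattice L', where Y acts, and L' lies in
    L; so pi^s Y preserves L, and s <= r. *)
Lemma PZ_bolytrope_sup (r : nat) :
  scalar_plus v Lam r `<=` PZ v (bolytrope v e r M).
Proof.
move=> _ [a [Y [ha hY ->]]] L [latL [_ [c' [L' [latL' invL'] <-]]]].
move=> [s [[L1 [L2 [[n _ eL1] [m _ eL2] sub12 sub21]]] _] sr] x hx.
rewrite mulmxDl mul_scalar_mx; apply: (free_submoduleD latL).
  exact: (free_submoduleZ latL).
have : L1 (pi ^ n *: x) by rewrite -eL1; exists x.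
move=> /(fun h => sub12 _ (ex_intro2 _ _ _ h erefl)); rewrite -eL2.
move=> [z hz ez].
have hYz : L' (Y *m z).
  by rewrite -invL'; exists 1%N, (fun=> Y), (fun=> z); split=> //; rewrite big_ord1.
have : L1 (pi ^ m *: (Y *m z)) by apply: sub21; rewrite -eL2; exists (Y *m z).
rewrite -eL1 => -[w hw ew].
have -> : (pi ^+ r *: Y) *m x = pi ^+ (r - s) *: w.
  apply: (scalerI (uniformizer_expz_neq0 v n)).
  transitivity (pi ^+ (r - s) *: (pi ^ n *: w)); last by rewrite !scalerA mulrC.
  rewrite ew (scalemxAr (pi ^ m)) ez -!scalemxAr -scalemxAl !scalerA; congr (_ *: _).
  by rewrite -{1}(subnK sr) exprD; ring.
apply: (free_submoduleZ latL) => //.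
exact: max_ideal_pow_le (max_ideal_pow_expn v (r - s)).
Qed.

(** These are the vectors [X *m tnth e j] with [X] in Lambda(M): the j-th column of the order,
    viewed as a lattice. *)
Definition column_lattice (j : 'I_d) : set 'cV[K]_d :=
  [set x | forall i, mp (M i j) (coord e i x)].

Definition column_basis (j i : 'I_d) : 'cV[K]_d := pi ^ M i j *: tnth e i.

Lemma column_lattice_span j : span_over v (column_basis j) = column_lattice j.
Proof. exact: (box_span v (coord_expand he) (coord_sum he)). Qed.

Lemma column_basis_independent j : independent_over v (column_basis j).
Proof.
exact: (box_independent (phi := fun i x => coord e i x) (coord_sum he)).
Qed.

Lemma column_lattice_is_lattice j : is_lattice v (column_lattice j).
Proof.
rewrite -column_lattice_span; apply: free_submodule_span; first exact: card_ord.
exact: column_basis_independent.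
Qed.

(** Stability is the triangle inequality M_ij <= M_il + M_lj; the reverse inclusion uses the
    identity matrix. *)
Lemma column_lattice_invariant j :
  invariant_classes v Lam (homothety_class v (column_lattice j)).
Proof.
have latL := column_lattice_is_lattice j.
exists (column_lattice j) => //; split=> //; apply/seteqP; split=> x.
  move=> [n [X [y [hXy ->]]]] i.
  rewrite linear_sum; apply: max_ideal_pow_sum => k _ /=.
  have [hX hy] := hXy k; rewrite (coord_mulmx he); apply: max_ideal_pow_sum => l _.
  apply: max_ideal_pow_le (proj2 hM i l j) _.
  exact: max_ideal_powM.
move=> hx; exists 1%N, (fun=> 1%:M), (fun=> x); split.
  by move=> _; split=> //; apply: full_order1 (Lambda_full_order v he hM).
by rewrite big_ord1 mul1mx.
Qed.

(* The lattices [O w + pi^r L] with [w] in [L] detect that a matrix is scalar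
   modulo [pi^r]: they force [w] to be an eigenvector modulo [pi^r L]. *)
Lemma PZ_bolytrope_eigenvector (r : nat) (X : 'M[K]_d) (j i0 : 'I_d)
    (c : 'I_d -> K) :
  PZ v (bolytrope v e r M) X -> (forall i, mp 0 (c i)) -> c i0 = 1 ->
  let w := \sum_i c i *: column_basis j i in
  exists2 a, mp 0 a & exists2 y, column_lattice j y & X *m w = a *: w + pi ^+ r *: y.
Proof.
move=> hX hc ci0 w; pose N := adjoin_scaled v r w (column_lattice j).
have latL := column_lattice_is_lattice j.
have latN : is_lattice v N.
  rewrite /N -column_lattice_span; apply: free_submodule_adjoin ci0 => //.
    exact: card_ord.
  exact: column_basis_independent.
have hw : column_lattice j w.
  rewrite -column_lattice_span; exists c; split=> // i.
  exact/valuation_ringE.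
have pi_int : mp 0 (pi ^+ r) by apply: max_ideal_pow_le (max_ideal_pow_expn v r).
(* N lies between pi^r L and L because w is in L, so its class is at distance at most r from an
   element of the center. *)
have BN : bolytrope v e r M (homothety_class v N).
  split; first by exists N.
  exists (homothety_class v (column_lattice j)); first exact: column_lattice_invariant.
  apply/is_dist_le/within_dist_homothety.
    move=> _ [x hx <-]; exists 0, x; split=> //; last by rewrite scale0r add0r.
    by apply/valuation_ringE/max_ideal_pow0.
  move=> _ [a [y [/valuation_ringE ha hy ->]]].
  by apply: (free_submoduleD latL); apply: (free_submoduleZ latL).
have Nw : N w.
  exists 1, 0; split; last by rewrite scale1r scaler0 addr0.
    exact/valuation_ringE/max_ideal_pow1.
  by move=> i; rewrite linear0; apply: max_ideal_pow0.
have [a [y [/valuation_ringE ha hy E]]] := hX N (conj latN BN) w Nw.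
by exists a => //; exists y.
Qed.

(** The test vector e_j bounds the off-diagonal entries of column j; the sum of the basis vectors of
    one column lattice then makes all diagonal entries congruent to a single scalar modulo pi^r. *)
Lemma PZ_bolytrope_sub (r : nat) : (0 < d)%N ->
  PZ v (bolytrope v e r M) `<=` scalar_plus v Lam r.
Proof.
move=> d0 X hX; have [M0 Mtri] := hM.
have off i j : i != j -> mp (r%:Z + M i j) (entry e X i j).
  move=> ij.
  (* With these coefficients w = e_j, as M_jj = 0. *)
  have [||a ha [y hy]] := @PZ_bolytrope_eigenvector r X j j (fun i => (i == j)%:R) hX.
  - by move=> k; apply: max_ideal_pow_nat.
  - by rewrite eqxx.
  rewrite (bigD1 j) //= eqxx big1 => [|k /negPf ->]; last by rewrite scale0r.
  rewrite addr0 scale1r /column_basis M0 expr0z scale1r => /(congr1 (coord e i)).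
  rewrite linearD !linearZ /= coord_tnth // (negPf ij) mulr0 add0r /entry => ->.
  by apply: max_ideal_powM => //; apply: max_ideal_pow_expn.
pose i0 := Ordinal d0.
(* With all coefficients 1 no coordinate of w vanishes, so one scalar [a] is compared with every
   diagonal entry. *)
have [|//|a ha [y hy]] := @PZ_bolytrope_eigenvector r X i0 i0 (fun=> 1) hX.
  by move=> _; apply: max_ideal_pow1.
under eq_bigr do rewrite scale1r; set w := \sum_i _ => E.
have diag i : mp r%:Z (entry e X i i - a).
  have cw k : coord e k w = pi ^ M k i0 by apply: coord_sum.
  have := congr1 (coord e i) E.
  rewrite linearD !linearZ /= (coord_mulmx he) (bigD1 i) //= cw => Ei.
  apply: (@max_ideal_pow_cancel _ v (M i i0)).
  rewrite mulrC mulrBl.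
  have -> : entry e X i i * pi ^ M i i0 - a * pi ^ M i i0 = pi ^+ r * coord e i y -
     \sum_(k | k != i) entry e X i k * coord e k w.
    by rewrite -[in RHS](addKr (a * pi ^ M i i0) (pi ^+ r * _)) -Ei; ring.
  apply: max_ideal_powB.
    by rewrite addrC; apply: max_ideal_powM => //; apply: max_ideal_pow_expn.
  apply: max_ideal_pow_sum => k ki; rewrite cw.
  (* By the triangle inequality the off-diagonal terms stay in the ideal of exponent r + M_i,i0. *)
  apply: (@max_ideal_pow_le _ _ _ (r%:Z + M i k + M k i0)).
    by have := Mtri i k i0; lia.
  apply: max_ideal_powM; last exact: max_ideal_pow_expz.
  by apply: off; rewrite eq_sym.
exists a, (pi ^- r *: (X - a%:M)); split=> //; last first.
  by rewrite scalerA mulfV ?uniformizerX_neq0 // scale1r addrC subrK.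
move=> i j; rewrite -/(entry _ _ _ _) entryZ.
apply: (@max_ideal_pow_cancel _ v r%:Z); rewrite -exprnP mulVKf ?uniformizerX_neq0 //.
have -> : X - a%:M = X + (-1) *: a%:M by rewrite scaleN1r.
rewrite entryD entryZ (entry_scalar he) mulN1r.
case: eqVneq => [->|ij]; first by rewrite mulr1 M0 addr0.
by rewrite mulr0 subr0; apply: off.
Qed.

Lemma PZ_bolytrope (r : nat) : (0 < d)%N ->
  PZ v (bolytrope v e r M) = scalar_plus v Lam r.
Proof.
move=> d0; apply/seteqP; split; first exact: PZ_bolytrope_sub.
exact: PZ_bolytrope_sup.
Qed.

(** The only entry of M is 0, so Lambda(M) already consists of the integral scalars. *)
Lemma scalar_plus_dim1 k : d = 1%N -> scalar_plus v Lam k = Lam.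
Proof.
move=> d1; have LamP := Lambda_full_order v he hM.
apply/seteqP; split=> X; first exact: scalar_plus_incl.
move=> hX; have d0 : (0 < d)%N by rewrite d1.
pose i0 := Ordinal d0.
have all0 i : i = i0 by apply/val_inj; have := ltn_ord i; rewrite /= {2}d1; case: (val i).
suff -> : X = (entry e X i0 i0)%:M.
  by apply: (scalar_plus_scalar LamP); have := hX i0 i0; rewrite (proj1 hM).
apply: (entry_inj he) => i j; rewrite (entry_scalar he) (all0 i) (all0 j).
by rewrite eqxx mulr1.
Qed.

Lemma first_graduated_term_bolytrope (r : nat) : (0 < d)%N ->
  first_graduated_term v (PZ v (bolytrope v e r M)) Lam.
Proof.
move=> d0; have LamP := Lambda_full_order v he hM; rewrite PZ_bolytrope //.
have [d1|d1] := leqP d 1.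
  (* For d = 1 the chain starts at Lambda(M), so the index is 0 and not r. *)
  exists 0%N; split=> //; last exact: Lambda_graduated.
  by apply: scalar_plus_dim1; lia.
exists r; split; last 1 first.
(* Term j of the chain is S_(r-j) with r - j > 0, written as a successor. *)
- move=> j jr; have -> : r = ((r - j).-1.+1 + j)%N by lia.
  rewrite radical_idealizer_chain_scalar_plus //.
  exact: scalar_plus_not_graduated.
- by rewrite -[r in scalar_plus _ _ r]add0n radical_idealizer_chain_scalar_plus //
    scalar_plus0.
- exact: Lambda_graduated.
Qed.

End Bolytrope.

(** Two first indices of one chain coincide, since neither can precede the other. *)
Lemma first_graduated_term_inj (K : fieldType) (v : discrete_valuation K)
    (d : nat) (Lam0 Lam Lam' : set 'M[K]_d) :
  first_graduated_term v Lam0 Lam -> first_graduated_term v Lam0 Lam' ->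
  Lam = Lam'.
Proof.
move=> [i [<- gi mini]] [j [<- gj minj]].
suff -> : i = j by [].
case: (ltngtP i j) => // h; first by case: (minj i h).
by case: (mini j h).
Qed.

Theorem mainTheorem3 (K : fieldType) (v : discrete_valuation K)
    (d : nat) (hd : (0 < d)%N)
    (e : d.-tuple 'cV[K]_d) (he : basis_of {:'cV[K]_d} e)
    (M : 'M[int]_d) (hM : polytrope_mx M) (r : nat) :
  [/\ is_order v (PZ v (bolytrope v e r M)),
      first_graduated_term v (PZ v (bolytrope v e r M)) (Lambda v e M) &
      forall (e' : d.-tuple 'cV[K]_d) (M' : 'M[int]_d) (r' : nat),
        basis_of {:'cV[K]_d} e' -> polytrope_mx M' ->
        bolytrope v e r M = bolytrope v e' r' M' ->
        invariant_classes v (Lambda v e M) =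
        invariant_classes v (Lambda v e' M')].
Proof.
have first_term := first_graduated_term_bolytrope.
split; first by rewrite PZ_bolytrope //; apply: scalar_plus_Lambda_is_order.
  exact: first_term.
(* [PZ] depends only on the set of classes, so both orders are the first graduated term of the same
   chain, and even the orders agree. *)
move=> e' M' r' he' hM' eB; congr invariant_classes.
apply: (first_graduated_term_inj (first_term _ v d e he M hM r hd)).
by rewrite eB; apply: first_term.
Qed.
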